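(* Let $K$ be a compact Hausdorff topological space. A function $x\in C(K)$ is an extreme point of the closed unit ball of $(C(K),\|\cdot\|_d)$ if and only if either (i) $x(t)=1$ or $0$ for every $t\in K$, or (ii) $x(t)=-1$ or $0$ for every $t\in K$ (and $\{t\in K:x(t)\ne0\}\ne\varnothing$ in each case).
   Context: $C(K)$ is the space of continuous real functions on $K$, and $\|\cdot\|_d$ is the norm on $C(K)$ given by $\|x\|_d=\|x^+\|_\infty+\|x^-\|_\infty=\max\{\|x\|_\infty,\operatorname{diam}(x)\}$, where $\|x\|_\infty=\sup_{t\in K}|x(t)|$, $x^\pm$ are the positive and negative parts of $x$, and $\operatorname{diam}(x)=\sup\{|x(s)-x(t)|:s,t\in K\}$. *)

(* Defs.v *)
From mathcomp Require Import all_boot all_order all_algebra.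
From mathcomp Require Import all_classical all_reals all_analysis.
Set Implicit Arguments.
Unset Strict Implicit.
Unset Printing Implicit Defensive.
Import Order.TTheory GRing.Theory Num.Theory.
Import numFieldNormedType.Exports.
Local Open Scope classical_set_scope.
Local Open Scope ring_scope.

Definition extreme_point (R : realType) (E : lmodType R) (A : set E) (x : E) :
    Prop :=
  A x /\
  forall (y z : E) (l : R), A y -> A z -> 0 < l < 1 ->
    x = l *: y + (1 - l) *: z -> y = x /\ z = x.

(* [sup] is the genuine supremum only on nonempty bounded-above sets, i.e. for
   bounded [x] on a nonempty [K]; this covers continuous [x] on compact [K]. *)
Definition sup_norm (R : realType) (K : Type) (x : K -> R) : R :=
  sup (range (fun t => `|x t|)).

Definition norm_d (R : realType) (K : Type) (x : K -> R) : R :=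
  sup_norm x^\+ + sup_norm x^\-.

(* [C(K)] is represented as a subset of the vector space of all functions
   [K -> R], with pointwise operations; the codomain is written [R^o], which is
   [R] seen as a module over itself. *)
Definition C_ (R : realType) (K : topologicalType) : set (K -> R^o) :=
  [set x | continuous x].

Definition closed_unit_ball_d (R : realType) (K : topologicalType) :
    set (K -> R^o) :=
  [set x | C_ x /\ norm_d x <= 1].

(* Main.v *)
Require Import Defs.
From mathcomp Require Import all_boot all_order all_algebra.
From mathcomp Require Import all_classical all_reals all_analysis.
From mathcomp Require Import ring lra.
Set Implicit Arguments.
Unset Strict Implicit.
Unset Printing Implicit Defensive.
Import Order.TTheory GRing.Theory Num.Theory.
Import numFieldNormedType.Exports.
Local Open Scope classical_set_scope.
Local Open Scope ring_scope.

(** The unit ball of [norm_d] consists of the continuous functions whose values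
    lie in an interval [[M - 1, M]] of length 1 containing 0: take for [M] the
    supremum of the positive part, so that the negative part is bounded by
    [1 - M] ([unit_ball_range], [unit_ball_of_range]). Everything else is read
    off this description.

    Let [x] be extreme, with values in [[M - 1, M]]. If [0 < M < 1], then
    [x = M (x^+ / M) + (1 - M) (- x^- / (1 - M))] is a convex combination of
    elements of the ball, the first nonnegative and the second nonpositive; both
    are equal to [x], so [x = 0]. But 0 is the midpoint of the constants 1 and
    -1, so [M] is 0 or 1, that is, [x] has constant sign. If [0 <= x <= 1], then
    [x] is the midpoint of [x^2] and [2 x - x^2], whose values are also in
    [[0, 1]]; hence [x = x^2] and [x] takes only the values 0 and 1.

    Conversely, let [x] take only the values 0 and 1, the value 1 at least once,
    and let [x] be a proper convex combination of [y] and [z] in the ball. Where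
    [x] is 1, both [y] and [z] are 1. An interval [[M - 1, M]] containing 1 has
    [M = 1], so [y] and [z] are nonnegative, and hence they vanish where [x]
    does.

    The nonpositive case is the nonnegative one applied to [- x]
    ([extreme_pointN]). *)

Lemma sup_norm_ub (R : realType) (K : topologicalType) (f : K -> R^o) (t : K) :
  compact [set: K] -> continuous f -> `|f t| <= sup_norm f.
Proof.
move=> K_compact f_cont; apply: ub_le_sup; last by exists t.
have normf_cont : {within [set: K], continuous (fun s => `|f s| : R)}.
  apply: continuous_subspaceT => s.
  exact: (continuous_comp (f_cont s) (@norm_continuous R R^o (f s))).
have [c _ c_max] := compact_EVT_max (ex_intro _ t I) K_compact normf_cont.
by exists `|f c| => _ [s _ <-]; apply: c_max; rewrite inE.
Qed.

Lemma sup_norm_le (R : realType) (K : Type) (f : K -> R) (c : R) :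
  [set: K] !=set0 -> (forall t, `|f t| <= c) -> sup_norm f <= c.
Proof.
move=> [t0 _] f_le; apply: ge_sup; first by exists `|f t0|, t0.
by move=> _ [t _ <-].
Qed.

Lemma continuous_funrpos (R : realType) (K : topologicalType) (x : K -> R^o) :
  continuous x -> continuous (x^\+ : K -> R^o).
Proof.
move=> x_cont t; apply: (@continuous_max R K x (cst 0) t); first exact: x_cont.
exact: cst_continuous.
Qed.

Lemma continuous_funrneg (R : realType) (K : topologicalType) (x : K -> R^o) :
  continuous x -> continuous (x^\- : K -> R^o).
Proof.
move=> x_cont; rewrite -funrposN; apply: continuous_funrpos => t.
by apply: continuousN; exact: x_cont.
Qed.

(** The interval comes from [M = sup x^+], because [norm_d x <= 1] leaves at most
    [1 - M] for the supremum of the negative part. *)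
Lemma unit_ball_range (R : realType) (K : topologicalType) (x : K -> R^o) :
  [set: K] !=set0 -> compact [set: K] -> closed_unit_ball_d x ->
  exists2 M : R, 0 <= M <= 1 & forall t, M - 1 <= x t <= M.
Proof.
move=> [t0 _] K_compact [x_cont].
rewrite /norm_d.
have pos_le t : x^\+ t <= sup_norm x^\+.
  apply: le_trans (ler_norm _) _.
  exact/sup_norm_ub/continuous_funrpos.
have neg_le t : x^\- t <= sup_norm x^\-.
  apply: le_trans (ler_norm _) _.
  exact/sup_norm_ub/continuous_funrneg.
move=> norm_le1; exists (sup_norm x^\+).
  have := le_trans (funrpos_ge0 x t0) (pos_le t0).
  have := le_trans (funrneg_ge0 x t0) (neg_le t0).
  lra.
move=> t; move: (pos_le t) (neg_le t).
rewrite /funrpos /funrneg !ge_max => /andP[+ _] /andP[+ _].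
lra.
Qed.

Lemma unit_ball_of_range (R : realType) (K : topologicalType) (x : K -> R^o)
    (M : R) :
  [set: K] !=set0 -> continuous x ->
  0 <= M <= 1 -> (forall t, M - 1 <= x t <= M) -> closed_unit_ball_d x.
Proof.
move=> K_nonempty x_cont M01 x_range; split=> //; rewrite /norm_d.
have pos_le : sup_norm x^\+ <= M.
  apply: sup_norm_le => // t; rewrite ger0_norm ?funrpos_ge0 //.
  rewrite /funrpos ge_max; apply/andP; split; have := x_range t; lra.
have neg_le : sup_norm x^\- <= 1 - M.
  apply: sup_norm_le => // t; rewrite ger0_norm ?funrneg_ge0 //.
  rewrite /funrneg ge_max; apply/andP; split; have := x_range t; lra.
lra.
Qed.

Lemma unit_ballN (R : realType) (K : topologicalType) (x : K -> R^o) :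
  [set: K] !=set0 -> compact [set: K] ->
  closed_unit_ball_d x -> closed_unit_ball_d (- x).
Proof.
move=> K_nonempty K_compact Bx.
have [M M01 x_range] := unit_ball_range K_nonempty K_compact Bx.
apply: (@unit_ball_of_range _ _ _ (1 - M)) => //; last 1 first.
- by move=> t; have := x_range t; rewrite fctE; lra.
- by move=> t; apply: continuousN; exact: (proj1 Bx).
- lra.
Qed.

Lemma extreme_pointN (R : realType) (E : lmodType R) (A : set E) (x : E) :
  (forall y, A y -> A (- y)) -> extreme_point A x -> extreme_point A (- x).
Proof.
move=> AN [Ax x_ext]; split; first exact: AN.
move=> y z l Ay Az l01 xE.
have [|yx zx] := x_ext _ _ l (AN _ Ay) (AN _ Az) l01; last first.
  by rewrite -{1}yx -zx !opprK.
by rewrite !scalerN -opprD -xE opprK.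
Qed.

Lemma extreme_point_midpoint (R : realType) (E : lmodType R) (A : set E)
    (x y z : E) :
  extreme_point A x -> A y -> A z -> x = 2^-1 *: y + 2^-1 *: z -> y = x.
Proof.
move=> [_ x_ext] Ay Az xE.
have half : 1 - 2^-1 = 2^-1 :> R by field.
by have [||->] := x_ext y z 2^-1 Ay Az; rewrite ?half //; lra.
Qed.

(** 0 is the midpoint of the constants 1 and -1, whose [norm_d] is 1. *)
Lemma extreme_point_neq0 (R : realType) (K : topologicalType) (x : K -> R^o) :
  [set: K] !=set0 -> extreme_point (@closed_unit_ball_d R K) x ->
  [set t | x t <> 0] !=set0.
Proof.
move=> K_nonempty x_ext; apply: contrapT => x_eq0.
have x0 t : x t = 0 by apply: contrapT => xt; apply: x_eq0; exists t.
have cst_ball (c M : R) : 0 <= M <= 1 -> M - 1 <= c <= M ->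
    closed_unit_ball_d (cst c : K -> R^o).
  move=> M01 cM; apply: (@unit_ball_of_range _ _ _ M) => // t.
  exact: cst_continuous.
have xE : cst 1 = x.
  apply: (@extreme_point_midpoint _ _ _ _ _ (cst (-1))) x_ext _ _ _.
  - by apply: (cst_ball _ 1); lra.
  - by apply: (cst_ball _ 0); lra.
  - by apply/funext => t; rewrite x0 !fctE /GRing.scale /=; lra.
by have [t _] := K_nonempty; have := congr1 (@^~ t) xE; rewrite /= x0; lra.
Qed.

(** With [M = sup x^+], rescaling [x^+] by [1 / M] and [x^-] by [1 / (1 - M)]
    stays in the ball, and [x] is their convex combination with weights [M] and
    [1 - M]. Extremality makes it improper: [M] is 0 or 1. *)
Lemma extreme_point_sign (R : realType) (K : topologicalType) (x : K -> R^o) :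
  [set: K] !=set0 -> compact [set: K] ->
  extreme_point (@closed_unit_ball_d R K) x ->
  (forall t, 0 <= x t <= 1) \/ (forall t, -1 <= x t <= 0).
Proof.
move=> K_nonempty K_compact x_ext; have [Bx x_comb] := x_ext.
have [M M01 x_range] := unit_ball_range K_nonempty K_compact Bx.
have [M0|M_neq0] := eqVneq M 0.
  by right=> t; have := x_range t; rewrite M0; lra.
have [M1|M_neq1] := eqVneq M 1.
  by left=> t; have := x_range t; rewrite M1; lra.
have M_gt0 : 0 < M by move: M_neq0 M01; lra.
have M_lt1 : 0 < 1 - M by move: M_neq1 M01; lra.
pose p : K -> R^o := M^-1 *: (x^\+ : K -> R^o).
pose q : K -> R^o := - ((1 - M)^-1 *: (x^\- : K -> R^o)).
have pE t : p t = M^-1 * x^\+ t by [].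
have qE t : q t = - ((1 - M)^-1 * x^\- t) by [].
have p_ge0 t : 0 <= p t.
  by rewrite pE mulr_ge0 ?funrpos_ge0 // invr_ge0 ltW.
have q_le0 t : q t <= 0.
  by rewrite qE oppr_le0 mulr_ge0 ?funrneg_ge0 // invr_ge0 ltW.
have Bp : closed_unit_ball_d p.
  apply: (@unit_ball_of_range _ _ _ 1) => //; last 1 first.
  - move=> t; rewrite subrr p_ge0 /= pE mulrC ler_pdivrMr // mul1r.
    rewrite /funrpos ge_max; apply/andP; split; have := x_range t; lra.
  - move=> t; apply: continuousZl_tmp; exact: (continuous_funrpos (proj1 Bx)).
  - lra.
have Bq : closed_unit_ball_d q.
  apply: (@unit_ball_of_range _ _ _ 0) => //; last 1 first.
  - move=> t; rewrite q_le0 andbT sub0r qE lerN2 mulrC ler_pdivrMr // mul1r.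
    rewrite /funrneg ge_max; apply/andP; split; have := x_range t; lra.
  - move=> t; apply: continuousN; apply: continuousZl_tmp.
    exact: (continuous_funrneg (proj1 Bx)).
  - lra.
have xE : x = M *: p + (1 - M) *: q.
  rewrite /p /q scalerN !scalerA !divff ?gt_eqF // !scale1r.
  by rewrite -[LHS]funrposBneg.
have [|px qx] := x_comb p q M Bp Bq _ xE; first lra.
have [t xt] := extreme_point_neq0 K_nonempty x_ext.
by case: xt; have := p_ge0 t; have := q_le0 t; rewrite px qx; lra.
Qed.

(** [x^2] and [2 x - x^2 = 1 - (1 - x)^2] have midpoint [x] and stay in the
    interval from 0 to 1. *)
Lemma extreme_point_indicator (R : realType) (K : topologicalType)
    (x : K -> R^o) :
  [set: K] !=set0 -> (forall t, 0 <= x t <= 1) ->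
  extreme_point (@closed_unit_ball_d R K) x ->
  forall t, x t = 1 \/ x t = 0.
Proof.
move=> K_nonempty x01 x_ext; have [[x_cont _] _] := x_ext.
pose y : K -> R^o := fun t => x t * x t.
pose z : K -> R^o := (x + x) - y.
have y_cont : continuous y by move=> t; apply: continuousM; exact: x_cont.
have z_cont : continuous z.
  move=> t; apply: continuousB; last exact: y_cont.
  by apply: continuousD; exact: x_cont.
have zE t : z t = x t + x t - x t * x t :> R by [].
have yx : y = x.
  apply: (@extreme_point_midpoint _ _ _ _ _ z) x_ext _ _ _.
  - apply: (@unit_ball_of_range _ _ _ 1) => //; first lra.
    by move=> t; have := x01 t; rewrite /y; nra.
  - apply: (@unit_ball_of_range _ _ _ 1) => //; first lra.
    move=> t; rewrite zE; have /andP[x_ge0 x_le1] := x01 t.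
    by have := sqr_ge0 (1 - x t); rewrite subrr; nra.
  - have midE (a : R) : a = 2^-1 * (a * a) + 2^-1 * (a + a - a * a) by field.
    by apply/funext => t; exact: midE.
move=> t.
have /eqP : x t * (x t - 1) = 0.
  by rewrite mulrBr mulr1 -[X in X - _]/(y t) yx subrr.
by rewrite mulf_eq0 subr_eq0 => /orP[] /eqP; [right|left].
Qed.

(** The point where [x] is 1 fixes the interval of values of [y] and [z]; it is
    this that makes the value 0 an endpoint. *)
Lemma indicator_extreme_point (R : realType) (K : topologicalType)
    (x : K -> R^o) :
  [set: K] !=set0 -> compact [set: K] -> continuous x ->
  (forall t, x t = 1 \/ x t = 0) -> [set t | x t <> 0] !=set0 ->
  extreme_point (@closed_unit_ball_d R K) x.
Proof.
move=> K_nonempty K_compact x_cont x10 [t0 /= xt0].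
have {xt0} xt0 : x t0 = 1 by case: (x10 t0).
split.
  apply: (@unit_ball_of_range _ _ _ 1) => //; first lra.
  by move=> t; case: (x10 t) => ->; lra.
move=> y z l By Bz l01 xE.
have {}xE t : x t = l * y t + (1 - l) * z t by rewrite [in LHS]xE.
have [M M01 y_range] := unit_ball_range K_nonempty K_compact By.
have [N N01 z_range] := unit_ball_range K_nonempty K_compact Bz.
have at1 t : x t = 1 -> y t = 1 /\ z t = 1.
  move=> xt; have := xE t; have := y_range t; have := z_range t.
  rewrite xt => zt yt eq1; split; nra.
have [yt0 zt0] := at1 _ xt0.
(* The value 1 at [t0] forces both intervals to be [[0, 1]]. *)
have M1 : M = 1 by have := y_range t0; rewrite yt0; lra.
have N1 : N = 1 by have := z_range t0; rewrite zt0; lra.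
have at0 t : x t = 0 -> y t = 0 /\ z t = 0.
  move=> xt; have := xE t; have := y_range t; have := z_range t.
  rewrite xt M1 N1 => zt yt eq0; split; nra.
by split; apply/funext => t; case: (x10 t) => xt;
  rewrite xt; [case: (at1 t xt)|case: (at0 t xt)|
               case: (at1 t xt)|case: (at0 t xt)].
Qed.

Theorem theorem6 (R : realType) (K : topologicalType)
    (K_nonempty : [set: K] !=set0)
    (K_compact : compact [set: K])
    (K_hausdorff : hausdorff_space K)
    (x : K -> R^o) (x_CK : C_ x) :
  extreme_point (@closed_unit_ball_d R K) x <->
  ((forall t : K, x t = 1 \/ x t = 0) /\ [set t : K | x t <> 0] !=set0) \/
  ((forall t : K, x t = -1 \/ x t = 0) /\ [set t : K | x t <> 0] !=set0).
Proof.
have extN (w : K -> R^o) : extreme_point (@closed_unit_ball_d R K) w ->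
    extreme_point (@closed_unit_ball_d R K) (- w).
  by apply: extreme_pointN => y; exact: unit_ballN.
have NxE t : (- x) t = - x t by [].
split=> [x_ext|[[x10 x_neq0]|[x10 [t0 xt0]]]]; last 2 first.
- exact: indicator_extreme_point.
- rewrite -[x]opprK; apply/extN/indicator_extreme_point => //.
  + by move=> t; apply: continuousN; exact: x_CK.
  + by move=> t; rewrite NxE; case: (x10 t) => ->; [left|right]; lra.
  + by exists t0 => /=; rewrite NxE => xt; apply: xt0; lra.
have x_neq0 := extreme_point_neq0 K_nonempty x_ext.
have [x01|x01] := extreme_point_sign K_nonempty K_compact x_ext.
  by left; split=> //; exact: extreme_point_indicator.
right; split=> // t.
have Nx01 s : 0 <= (- x) s <= 1 by rewrite NxE; have := x01 s; lra.
by case: (extreme_point_indicator K_nonempty Nx01 (extN _ x_ext) t);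
  rewrite NxE => xt; [left|right]; move: xt; lra.
Qed.
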